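(* The two characteristic functions are invariants of positive congruence classes of cross cap germs. That is: for $i=1,2$, let $U_i$ be a neighborhood of $p_i$ in $\mathbf{R}^2$, let $f_i:U_i\to\mathbf{R}^3$ be a $C^\infty$-map having a cross cap singular point at $p_i$, and let $a_i(u,v)$ and $b_i(v)$ be a first and a second characteristic function of $f_i$ at $p_i$. If $f_2$ is positively congruent to $f_1$ as a map germ, then there exists $\epsilon>0$ such that $a_1(u,v)=a_2(u,v)$ and $b_1(v)=b_2(v)$ hold for all $u,v$ with $|u|,|v|<\epsilon$.
   Context: A $C^\infty$-map $f:U\to\mathbf{R}^3$ from a domain $U\subset\mathbf{R}^2$ has a cross cap singular point at $p\in U$ if its germ at $p$ is right-left equivalent (by local diffeomorphisms of source and target) to the germ at the origin of $(u,v)\mapsto(u,uv,v^2)$. A local coordinate system of $\mathbf{R}^2$ is positive if its Jacobian with respect to the standard coordinates is positive. Characteristic functions: if $f$ has a cross cap at $p$, it is known that there exist a positive local coordinate system $(u,v)$ centered at $p$ (a Bruce-West coordinate system), an orientation preserving isometry $S$ of $\mathbf{R}^3$, and $C^\infty$-functions $a(u,v)$, $b(v)$ satisfying $b(0)=b'(0)=b''(0)=0$, $a(0,0)=a_u(0,0)=a_v(0,0)=0$, $a_{vv}(0,0)>0$, such that near $p$ $$S\circ f(u,v)=\bigl(u,\;uv+b(v),\;a(u,v)\bigr).$$ For any such representation, $a$ is called the first characteristic function and $b$ the second characteristic function of $f$ at $p$; they are considered as function germs at the origin. Positive congruence: $f_2$ is congruent to $f_1$ as a map germ if there exist an isometry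 $T$ of $\mathbf{R}^3$ and a diffeomorphism germ $\varphi$ with $\varphi(p_1)=p_2$ such that $f_1=T\circ f_2\circ\varphi$ holds on a sufficiently small neighborhood of $p_1$. If moreover $T$ and $\varphi$ are both orientation preserving, $f_2$ is said to be positively congruent to $f_1$. *)

(* Defs.v *)
From HB Require Import structures.
From mathcomp Require Import all_boot all_order all_algebra.
From mathcomp Require Import boolp classical_sets functions reals.
From mathcomp Require Import topology normedtype derive.

Set Implicit Arguments.
Unset Strict Implicit.
Unset Printing Implicit Defensive.

Import Order.TTheory GRing.Theory Num.Theory.
Import numFieldNormedType.Exports.

Local Open Scope classical_set_scope.
Local Open Scope ring_scope.

(* [Ck_on k U f] is meant for [U] open, where it only depends on the
   restriction of [f] to [U] and, in finite dimension, says that [f] is of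
   class C^k on [U]. *)
Fixpoint Ck_on (R : realType) (V W : normedModType R) (k : nat)
    (U : set V) (f : V -> W) : Prop :=
  match k with
  | 0 => forall x, U x -> {for x, continuous f}
  | k'.+1 => (forall x, U x -> differentiable f x) /\
             (forall v : V, Ck_on k' U ('D_v f))
  end.

Definition smooth_on (R : realType) (V W : normedModType R)
    (U : set V) (f : V -> W) : Prop :=
  forall k, Ck_on k U f.

Definition smooth_at (R : realType) (V W : normedModType R)
    (f : V -> W) (x : V) : Prop :=
  exists2 U : set V, open_nbhs x U & smooth_on U f.

Definition diffeo_germ (R : realType) (V W : normedModType R)
    (phi : V -> W) (x : V) : Prop :=
  exists (A : set V) (B : set W) (psi : W -> V),
    [/\ open_nbhs x A /\ open_nbhs (phi x) B,
        smooth_on A phi /\ smooth_on B psi,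
        (forall y, A y -> B (phi y) /\ psi (phi y) = y) &
        (forall z, B z -> A (psi z) /\ phi (psi z) = z)].

Definition positive_diffeo_germ (R : realType) (n : nat)
    (phi : 'rV[R]_n -> 'rV[R]_n) (x : 'rV[R]_n) : Prop :=
  diffeo_germ phi x /\ \forall y \near x, 0 < \det (jacobian phi y).

(* The library's norm on row vectors is the sup norm. *)
Definition euclidean_dist (R : realType) (n : nat) (x y : 'rV[R]_n) : R :=
  Num.sqrt (\sum_(i < n) (x 0 i - y 0 i) ^+ 2).

Definition euclidean_isometry (R : realType) (n : nat)
    (T : 'rV[R]_n -> 'rV[R]_n) : Prop :=
  forall x y, euclidean_dist (T x) (T y) = euclidean_dist x y.

Definition positive_isometry (R : realType) (n : nat)
    (T : 'rV[R]_n -> 'rV[R]_n) : Prop :=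
  euclidean_isometry T /\ forall x, 0 < \det (jacobian T x).

Definition positively_congruent (R : realType) (m n : nat)
    (f2 : 'rV[R]_m -> 'rV[R]_n) (p2 : 'rV[R]_m)
    (f1 : 'rV[R]_m -> 'rV[R]_n) (p1 : 'rV[R]_m) : Prop :=
  exists (T : 'rV[R]_n -> 'rV[R]_n) (phi : 'rV[R]_m -> 'rV[R]_m),
    [/\ positive_isometry T, positive_diffeo_germ phi p1, phi p1 = p2 &
        \forall x \near p1, f1 x = T (f2 (phi x))].

Definition right_left_equivalent (R : realType) (V W : normedModType R)
    (f : V -> W) (p : V) (g : V -> W) (q : V) : Prop :=
  exists (phi : V -> V) (Phi : W -> W),
    [/\ diffeo_germ phi p, phi p = q, diffeo_germ Phi (f p) &
        \forall x \near p, Phi (f x) = g (phi x)].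

Definition vec2 (R : realType) (x y : R) : 'rV[R]_2 :=
  \row_(i < 2) [:: x; y]`_i.

Definition vec3 (R : realType) (x y z : R) : 'rV[R]_3 :=
  \row_(i < 3) [:: x; y; z]`_i.

Definition standard_cross_cap (R : realType) (w : 'rV[R]_2) : 'rV[R]_3 :=
  let u := w 0 0 in let v := w 0 1 in vec3 u (u * v) (v ^+ 2).

Definition cross_cap_at (R : realType)
    (f : 'rV[R]_2 -> 'rV[R]_3) (p : 'rV[R]_2) : Prop :=
  right_left_equivalent f p (@standard_cross_cap R) 0.

Definition bruce_west_map (R : realType)
    (a : 'rV[R]_2 -> R) (b : R -> R) (w : 'rV[R]_2) : 'rV[R]_3 :=
  let u := w 0 0 in let v := w 0 1 in vec3 u (u * v + b v) (a w).

(* [chart] sends a point near [p] to its coordinates [(u, v)], so that the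
   map written [f(u, v)] in these coordinates is [f \o chart^-1]. *)
Definition bruce_west_representation (R : realType)
    (f : 'rV[R]_2 -> 'rV[R]_3) (p : 'rV[R]_2)
    (a : 'rV[R]_2 -> R) (b : R -> R) : Prop :=
  let e1 := vec2 1 0 : 'rV[R]_2 in
  let e2 := vec2 0 1 : 'rV[R]_2 in
  [/\ smooth_at a 0 /\ smooth_at b 0,
      [/\ b 0 = 0, (b^`() 0)%classic = 0 & (b^`(2) 0)%classic = 0],
      [/\ a 0 = 0, 'D_e1 a 0 = 0, 'D_e2 a 0 = 0 & 0 < 'D_e2 ('D_e2 a) 0] &
      exists (chart : 'rV[R]_2 -> 'rV[R]_2) (S : 'rV[R]_3 -> 'rV[R]_3),
        [/\ positive_diffeo_germ chart p, chart p = 0, positive_isometry S &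
            \forall q \near p, S (f q) = bruce_west_map a b (chart q)]].

Definition first_characteristic_function (R : realType)
    (f : 'rV[R]_2 -> 'rV[R]_3) (p : 'rV[R]_2) (a : 'rV[R]_2 -> R) : Prop :=
  exists b : R -> R, bruce_west_representation f p a b.

Definition second_characteristic_function (R : realType)
    (f : 'rV[R]_2 -> 'rV[R]_3) (p : 'rV[R]_2) (b : R -> R) : Prop :=
  exists a : 'rV[R]_2 -> R, bruce_west_representation f p a b.

(* Main.v *)
Require Import Defs.
From HB Require Import structures.
From mathcomp Require Import all_boot all_order all_algebra.
From mathcomp Require Import boolp classical_sets functions reals.
From mathcomp Require Import topology normedtype derive realfun.
From mathcomp Require Import ring lra.

(** The characteristic functions can be read off the germ because the
    transition between two Bruce-West normal forms related by a positive
    congruence is the identity.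

    Write F_i (u, v) = (u, u v + b_i v, a_i (u, v)). In the two charts the
    congruence becomes F_1 = (F_2 o phi) Q near 0, with phi = (U, V) a local
    diffeomorphism that fixes 0 and has positive Jacobian, and Q a rotation
    ([bruce_west_transition]). The proof determines Q, then phi.

    To first order at 0 the differential of F_i has rank one with image the
    first axis, so Q maps that axis to itself and U = eps u with eps = 1 or -1
    ([transition_first_order]). The second derivative of F_i along the v-axis
    is a positive multiple of the third axis; comparing both sides gives
      Q = diag (eps, eps, 1)
    ([transition_second_order], [rotation3_diag]). The relation between the
    second coordinates is now
      u v + b_1 v = u V + eps b_2 V.
    As b_2 vanishes at 0 with two derivatives, V_v = 1 at 0
    ([graph_fibre_speed]), so the Jacobian of phi at 0 is eps, and positivity
    gives eps = 1. This is where the orientations of the congruence matter.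

    There remains u v + b_1 v = u V + b_2 V, where V = v must be shown
    ([graph_rigidity]). On the curve of singular points of the map
    (u, v) |-> (u, u v + b_1 v), the derivative of this identity along u gives
    V = v; hence b_1 and b_2 have the same derivative and coincide. Outside
    that curve, the mean value theorem and the smallness of the second
    derivative of b_2 near 0 exclude V <> v. So phi is the identity and
    a_1 = a_2. *)

Set Implicit Arguments.
Unset Strict Implicit.
Unset Printing Implicit Defensive.
Import Order.TTheory GRing.Theory Num.Theory.
Import numFieldNormedType.Exports.
Local Open Scope classical_set_scope.
Local Open Scope ring_scope.

(** * Euclidean isometries and rotations *)

Lemma isometry_sqdist (R : realType) (n : nat) (T : 'rV[R]_n -> 'rV[R]_n) :
  euclidean_isometry T -> forall x y,
  \sum_(i < n) (T x 0 i - T y 0 i) ^+ 2 = \sum_(i < n) (x 0 i - y 0 i) ^+ 2.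
Proof.
move=> isoT x y; have sumge0 (u v : 'rV[R]_n) :
    0 <= \sum_(i < n) (u 0 i - v 0 i) ^+ 2.
  by apply: sumr_ge0 => i _; exact: sqr_ge0.
rewrite -(sqr_sqrtr (sumge0 (T x) (T y))) -(sqr_sqrtr (sumge0 x y)).
by rewrite -[Num.sqrt _]/(euclidean_dist _ _) isoT.
Qed.

(** Polarization: the inner product of x - z and y - z is a combination of the
    three squared distances between x, y and z, taken here at z = 0. *)
Lemma isometry_dot (R : realType) (n : nat) (T : 'rV[R]_n -> 'rV[R]_n) :
  euclidean_isometry T -> forall x y,
  (T x - T 0) *m (T y - T 0)^T = x *m y^T.
Proof.
move=> isoT x y; apply/matrixP => i j; rewrite !ord1 {i j} !mxE.
have polar (u v w : 'rV[R]_n) : \sum_(i < n) (u 0 i - w 0 i) * (v 0 i - w 0 i) =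
    2^-1 * (\sum_(i < n) (u 0 i - w 0 i) ^+ 2
            + \sum_(i < n) (v 0 i - w 0 i) ^+ 2
            - \sum_(i < n) (u 0 i - v 0 i) ^+ 2).
  by rewrite -big_split -sumrB mulr_sumr; apply: eq_bigr => i _ /=; field.
transitivity (\sum_(i < n) (T x 0 i - T 0 0 i) * (T y 0 i - T 0 0 i)).
  by apply: eq_bigr => i _; rewrite !mxE.
rewrite polar !isometry_sqdist // -polar.
by apply: eq_bigr => i _; rewrite !mxE !subr0.
Qed.

(** A map that fixes inner products is linear: its coordinates in the image of
    the canonical basis are those of the argument in the canonical basis. *)
Lemma isometry_affine (R : realType) (n : nat) (T : 'rV[R]_n -> 'rV[R]_n) :
  euclidean_isometry T ->
  exists2 A : 'M[R]_n, A *m A^T = 1%:M & forall x, T x = x *m A + T 0.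
Proof.
move=> isoT.
(* T - T 0 preserves inner products; its matrix has the images of the
   canonical basis as rows. *)
pose A := \matrix_i (T (delta_mx 0 i) - T 0).
have dotA x : (T x - T 0) *m A^T = x.
  apply/rowP => i; transitivity ((x *m (delta_mx 0 i : 'rV[R]_n)^T) 0 0).
    rewrite -(isometry_dot isoT) !mxE.
    by apply: eq_bigr => k _; rewrite !mxE.
  by rewrite trmx_delta -colE mxE.
have AAT : A *m A^T = 1%:M.
  by apply/row_matrixP => i; rewrite row_mul rowK dotA row1.
exists A => // x.
have /(congr1 (mulmx^~ A)) := dotA x.
by rewrite -mulmxA (mulmx1C AAT) mulmx1 => <-; rewrite subrK.
Qed.

Lemma differentiable_affine_mx (R : realType) (m n : nat)
    (A : 'M[R]_(m, n)) c x :
  differentiable (fun x : 'rV[R]_m => x *m A + c) x.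
Proof.
have -> : (fun x : 'rV[R]_m => x *m A + c) =
    \sum_k (fun x : 'rV[R]_m => x 0 k *: row k A) + cst c.
  by apply/funext => y; rewrite fctE mulmx_sum_row fct_sumE.
apply: differentiableD => //; apply: differentiable_sum => k.
apply: differentiableZl; exact: differentiable_coord.
Qed.

Lemma jacobian_affine (R : realType) (m n : nat) (A : 'M[R]_(m, n)) c x :
  jacobian (fun x : 'rV[R]_m => x *m A + c) x = A.
Proof.
have dA := @differentiable_affine_mx R m n A.
apply/row_matrixP => i; rewrite !rowE -deriveEjacobian //.
apply: cvg_lim => //.
apply: (@cvg_trans _ (cst (delta_mx 0 i *m A) @ 0^')); last first.
  exact: cvg_cst.
apply: near_eq_cvg; near=> h.
have h0 : h != 0 by near: h; exact: nbhs_dnbhs_neq.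
rewrite /= mulmxDl addrAC opprD addrA addrK addrAC -addrA subrr addr0.
by rewrite -scalemxAl scalerA mulVf ?scale1r.
Unshelve. all: by end_near. Qed.

Lemma positive_isometry_affine (R : realType) (n : nat)
    (T : 'rV[R]_n -> 'rV[R]_n) :
  positive_isometry T ->
  exists A : 'M[R]_n,
    [/\ A *m A^T = 1%:M, 0 < \det A & forall x, T x = x *m A + T 0].
Proof.
move=> [/isometry_affine[A AAT TA] /(_ 0)].
by rewrite [X in jacobian X](funext TA) jacobian_affine => detA; exists A.
Qed.

Lemma orthogonal3E (R : realType) (Q : 'M[R]_3) : Q *m Q^T = 1%:M ->
  forall i j, Q i 0 * Q j 0 + Q i 1 * Q j 1 + Q i ord_max * Q j ord_max
              = (i == j)%:R.
Proof.
move=> QQT i j; have := congr1 (fun M : 'M[R]_3 => M i j) QQT.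
rewrite !mxE => <-; rewrite !big_ord_recl big_ord0 !mxE addr0 addrA.
by congr (_ + _ + _); congr (Q _ _ * Q _ _); apply: val_inj.
Qed.

(** The first row is Q 0 0 times the first basis vector, and the rows
    orthogonal to it have no first entry. *)
Lemma orthogonal3_first_row (R : realType) (Q : 'M[R]_3) :
  Q *m Q^T = 1%:M -> Q 0 1 = 0 -> Q 0 ord_max = 0 ->
  [/\ Q 0 0 ^+ 2 = 1, Q 1 0 = 0 & Q ord_max 0 = 0].
Proof.
move=> QQT Q01 Q02; have QE := orthogonal3E QQT.
have := QE 0 0; rewrite Q01 Q02 !mulr0 !addr0 /= -expr2 => Q00.
have Q00n0 : Q 0 0 != 0 by rewrite -sqrf_eq0 Q00 oner_eq0.
split=> //; apply: (mulIf Q00n0); rewrite mul0r.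
  by have := QE 1 0; rewrite Q01 Q02 !mulr0 !addr0.
by have := QE ord_max 0; rewrite Q01 Q02 !mulr0 !addr0.
Qed.

(** Orthogonality makes Q diagonal with entries of square 1; the determinant
    and the sign of the last entry leave only diag (eps, eps, 1). *)
Lemma rotation3_diag (R : realType) (Q : 'M[R]_3) :
  Q *m Q^T = 1%:M -> 0 < \det Q -> Q 0 1 = 0 -> Q 0 ord_max = 0 ->
  Q ord_max 1 = 0 -> 0 < Q ord_max ord_max ->
  [/\ Q 1 1 = Q 0 0, Q 1 ord_max = 0 & Q ord_max ord_max = 1].
Proof.
move=> QQT detQ Q01 Q02 Q21 Q22.
have [Q00 Q10 Q20] := orthogonal3_first_row QQT Q01 Q02.
have QE := orthogonal3E QQT.
have := QE ord_max ord_max; rewrite Q20 Q21 !mulr0 !add0r eqxx => Q22E.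
have {}Q22E : Q ord_max ord_max = 1.
  by apply/eqP; rewrite -(@eqrXn2 _ 2) ?ltW // expr1n expr2 Q22E.
have := QE 1 ord_max; rewrite Q20 Q21 !mulr0 !add0r Q22E mulr1 => Q12.
have := QE 1 1; rewrite Q10 Q12 !mulr0 add0r addr0 eqxx => Q11.
have trigQ : is_trig_mx Q.
  apply/is_trig_mxP => -[[|[|[|//]]] ilt] [[|[|[|//]]] jlt] //= _.
  - by rewrite -Q01; congr (Q _ _); apply: val_inj.
  - by rewrite -Q02; congr (Q _ _); apply: val_inj.
  - by rewrite -[RHS]Q12; congr (Q _ _); apply: val_inj.
move: detQ; rewrite det_trig // !big_ord_recl big_ord0 mulr1.
have -> : lift ord0 (lift ord0 ord0) = ord_max :> 'I_3 by apply: val_inj.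
have -> : lift ord0 ord0 = 1 :> 'I_3 by apply: val_inj.
rewrite Q22E mulr1 => Q0011; split => //.
have Q00n0 : Q 0 0 != 0 by rewrite -sqrf_eq0 Q00 oner_eq0.
have /eqP : (Q 1 1 - Q 0 0) * (Q 1 1 + Q 0 0) = 0.
  by rewrite -subr_sqr Q00 expr2 Q11 subrr.
rewrite mulf_eq0 subr_eq0 => /orP[/eqP //|]; rewrite addr_eq0 => /eqP Q11N.
by move: Q0011; rewrite Q11N mulrN -expr2 Q00 ltr0N1.
Qed.

(** * Directional derivatives and one-variable calculus *)

Lemma near_continuous (T U : topologicalType) (f : T -> U) x (P : U -> Prop) :
  {for x, continuous f} -> (\forall y \near f x, P y) ->
  \forall y \near x, P (f y).
Proof. by move=> cf; exact: cf. Qed.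

Lemma near0_ball (R : realType) (V : normedModType R) (P : V -> Prop) :
  (\forall x \near (0 : V), P x) ->
  exists2 r : R, 0 < r & forall x, `|x| < r -> P x.
Proof.
move=> /nbhs_ballP[r /= r0 rP]; exists r => // x xr; apply: rP.
by rewrite -ball_normE /= sub0r normrN.
Qed.

Lemma near_ball0 (R : realType) (V : normedModType R) (P : V -> Prop) (r : R) :
  0 < r -> (forall x, `|x| < r -> P x) -> \forall x \near (0 : V), P x.
Proof.
move=> r0 rP; apply/nbhs_ballP; exists r => //= x.
by rewrite -ball_normE /= sub0r normrN; exact: rP.
Qed.

Lemma near_eq_derive_near (R : realType) (V W : normedModType R)
    (f g : V -> W) (x v : V) :
  (\forall y \near x, f y = g y) -> \forall y \near x, 'D_v f y = 'D_v g y.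
Proof.
move=> /nbhs_interior; apply: filterS => y fg; exact: near_eq_derive.
Qed.

Lemma is_derive_line (R : realType) (V W : normedModType R)
    (f : V -> W) x v df :
  is_derive x v f df <-> is_derive (0 : R) 1 (fun h => f (h *: v + x)) df.
Proof.
have E : (fun h : R => h^-1 *:
           ((fun h => f (h *: v + x)) (h *: 1 + 0) - f (0 *: v + x)))
       = (fun h : R => h^-1 *: (f (h *: v + x) - f x)).
  by apply/funext => h; rewrite /= addr0 scale0r add0r [_%:A]mulr1.
split=> -[dfx <-]; split.
- by move: dfx; rewrite /derivable /= E.
- by rewrite /derive /= E.
- by move: dfx; rewrite /derivable /= E.
- by rewrite /derive /= E.
Qed.

Lemma is_derive_comp1 (R : realType) (V : normedModType R) (f : R -> R)
    (g : V -> R) x v a b :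
  is_derive (g x) 1 f a -> is_derive x v g b -> is_derive x v (f \o g) (a * b).
Proof.
move=> df /is_derive_line dg; apply/is_derive_line.
apply: (@is_derive1_comp _ f (fun h => g (h *: v + x)) 0 a b) => //.
by rewrite scale0r add0r.
Qed.

(** Directional derivatives along the line spanned by e are ordinary
    derivatives of the restriction to that line; here at the level of
    difference quotients, so that it applies without differentiability. *)
Lemma axis_growth_rate (R : realType) (V W : normedModType R)
    (f : V -> W) e (t : R) :
  (fun h : R => h^-1 *:
     (((fun s : R => f (s *: e)) \o shift t) (h *: 1) - f (t *: e))) =
  (fun h : R => h^-1 *: ((f \o shift (t *: e)) (h *: e) - f (t *: e))).
Proof. by apply/funext => h; rewrite /= scalerDl [h *: 1]mulr1. Qed.

Lemma derivable_axis (R : realType) (V W : normedModType R)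
    (f : V -> W) e (t : R) :
  derivable f (t *: e) e -> derivable (fun s : R => f (s *: e)) t 1.
Proof. by rewrite /derivable axis_growth_rate. Qed.

Lemma derive_axis (R : realType) (V W : normedModType R) (f : V -> W) e :
  'D_1 (fun s : R => f (s *: e)) = fun t => 'D_e f (t *: e).
Proof. by apply/funext => t; rewrite /derive axis_growth_rate. Qed.

Lemma axis_continuous (R : realType) (V : normedModType R) (e : V) (t : R) :
  {for t, continuous (fun s : R => s *: e)}.
Proof. exact: scalel_continuous. Qed.

Lemma is_derive_axis0 (R : realType) (V W : normedModType R) (f : V -> W) e df :
  is_derive 0 e f df -> is_derive (0 : R) 1 (fun s : R => f (s *: e)) df.
Proof.
move=> /is_derive_line; congr (is_derive _ _ _ _).
by apply/funext => h; rewrite addr0.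
Qed.

(** Since h vanishes at x, the difference quotient of the product is that of h
    times k: continuity of the other factor is enough. It lets a second
    derivative be taken with only one continuous derivative of a change of
    variable. *)
Lemma is_derive_mul_vanishing (R : realType) (h k : R -> R) (x dh : R) :
  is_derive x 1 h dh -> h x = 0 -> {for x, continuous k} ->
  is_derive x 1 (fun y => h y * k y) (dh * k x).
Proof.
move=> /is_derive1_caratheodory[H [hE cH Hx]] hx ck.
apply/is_derive1_caratheodory; exists (fun y => H y * k y); split.
- by move=> z; rewrite hx mul0r subr0 -[h z]subr0 -hx hE mulrAC.
- exact: (@continuousM _ _ H k).
- by rewrite Hx.
Qed.

(** At a critical point of f the term f' g'' of the second derivative of f o g
    is absent, so g need not be twice differentiable. *)
Lemma derive2_comp_critical (R : realType) (f g : R -> R) (x m c : R) :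
  (\forall y \near g x, derivable f y 1) -> 'D_1 f (g x) = 0 ->
  is_derive (g x) 1 ('D_1 f) m ->
  (\forall y \near x, derivable g y 1) -> 'D_1 g x = c ->
  {for x, continuous ('D_1 g)} ->
  is_derive x 1 ('D_1 (f \o g)) (m * c ^+ 2).
Proof.
move=> df f'0 f'' dg g'c cg'.
have dgx : derivable g x 1 := nbhs_singleton dg.
have cg : {for x, continuous g}.
  exact/differentiable_continuous/derivable1_diffP.
have isg : is_derive x 1 g c by rewrite -g'c; exact: derivableP.
have dfg := near_continuous cg df.
rewrite expr2 mulrA -[X in _ * X]g'c.
apply: (@near_eq_is_derive _ _ _ (fun y => ('D_1 f \o g) y * 'D_1 g y)).
  apply: filterS (filterI dfg dg) => y [dfy dgy].
  by have [_ ->] := is_derive_comp1 (derivableP dfy) (derivableP dgy).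
apply: is_derive_mul_vanishing => //; exact: is_derive1_comp f'' isg.
Qed.

Lemma second_order_combination (R : realType) (f g : R -> R) (c d x df dg : R) :
  (\forall y \near x, derivable f y 1) ->
  (\forall y \near x, derivable g y 1) ->
  is_derive x 1 ('D_1 f) df -> is_derive x 1 ('D_1 g) dg ->
  [/\ \forall y \near x, derivable (fun y => f y * c + g y * d) y 1,
      'D_1 (fun y => f y * c + g y * d) x = 'D_1 f x * c + 'D_1 g x * d &
      is_derive x 1 ('D_1 (fun y => f y * c + g y * d)) (df * c + dg * d)].
Proof.
move=> nf ng f2 g2.
have comb (p q : R -> R) (dp dq y : R) :
    is_derive y 1 p dp -> is_derive y 1 q dq ->
    is_derive y 1 (fun y => p y * c + q y * d) (dp * c + dq * d).
  move=> pd qd; apply: is_derive_eq; rewrite /GRing.scale /=; ring.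
have fg1 : \forall y \near x, is_derive (y : R) 1 (fun y => f y * c + g y * d)
    ('D_1 f y * c + 'D_1 g y * d).
  apply: filterS (filterI nf ng) => y [fy gy].
  by apply: comb; exact: derivableP.
split; first by apply: filterS fg1 => y [].
  by have [] := nbhs_singleton fg1.
apply: (near_eq_is_derive _ (comb _ _ _ _ _ f2 g2)).
by apply: filterS fg1 => y [_ ->].
Qed.

(** The mean value theorem without an order on the end points: the
    intermediate point z is at least as close to y as x is. *)
Lemma mvt_ball (R : realType) (f : R -> R) (r x y : R) :
  (forall z, `|z| < r -> derivable f z 1) -> `|x| < r -> `|y| < r ->
  exists z, [/\ `|z| < r, `|z - y| <= `|y - x| &
                f y - f x = 'D_1 f z * (y - x)].
Proof.
move=> df.
have ball_itv a b z : `|a| < r -> `|b| < r -> a <= z <= b -> `|z| < r.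
  move=> /ltr_normlP[? ?] /ltr_normlP[? ?] /andP[? ?].
  by apply/ltr_normlP; split; lra.
have main a b : `|a| < r -> `|b| < r -> a <= b -> exists z,
    [/\ `|z| < r, a <= z <= b & f b - f a = 'D_1 f z * (b - a)].
  move=> ar br ab; have [||z zab fE] := @MVT_segment _ f ('D_1 f) a b ab.
  - move=> z /[!in_itv]/= /andP[az zb]; apply: derivableP; apply: df.
    by apply: (ball_itv a b); rewrite ?ltW.
  - apply: derivable_within_continuous => z; rewrite in_itv /= => azb.
    by apply: df; apply: (ball_itv a b).
  - exists z; move: zab; rewrite in_itv /= => zab; split=> //.
    exact: (ball_itv a b).
move=> xr yr; have [xy|/ltW yx] := leP x y.
  have [z [zr zxy fE]] := main _ _ xr yr xy; exists z; split => //.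
  by rewrite distrC !ger0_norm; lra.
have [z [zr zxy fE]] := main _ _ yr xr yx; exists z; split => //.
  by rewrite (distrC y) !ger0_norm; lra.
by apply: oppr_inj; rewrite opprB fE -mulrN opprB.
Qed.

(** * Germs of class C^1 and their Jacobians *)

(** Differentiable near x with partial derivatives continuous at x. This is
    all that the proof needs about changes of coordinates, and it is stable by
    composition with the chain rule alone. *)
Definition c1_at (R : realType) (V W : normedModType R) (f : V -> W)
    (x : V) : Prop :=
  (\forall y \near x, differentiable f y) /\
  forall v, {for x, continuous ('D_v f)}.

Lemma c1_differentiable (R : realType) (V W : normedModType R) (f : V -> W) x :
  c1_at f x -> differentiable f x.
Proof. by move=> [/nbhs_singleton]. Qed.

Lemma c1_continuous (R : realType) (V W : normedModType R) (f : V -> W) x :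
  c1_at f x -> {for x, continuous f}.
Proof. by move=> /c1_differentiable /differentiable_continuous. Qed.

Lemma smooth_on_c1 (R : realType) (V W : normedModType R) (U : set V)
    (f : V -> W) x :
  open U -> smooth_on U f -> U x -> c1_at f x.
Proof.
move=> oU /(_ 1%N) [df cf] Ux; split; last by move=> v; exact: cf.
by apply: filterS (open_nbhs_nbhs (conj oU Ux)) => y; exact: df.
Qed.

Lemma smooth_at_c1 (R : realType) (V W : normedModType R) (f : V -> W) x :
  smooth_at f x -> c1_at f x /\ forall v, c1_at ('D_v f) x.
Proof.
move=> [U [oU Ux] sf]; split=> [|v]; apply: (smooth_on_c1 oU) => // k.
by have [_] := sf k.+1; exact.
Qed.

Lemma c1_axis (R : realType) (V W : normedModType R) (f : V -> W) e :
  c1_at f 0 ->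
  (\forall t \near (0 : R), derivable (fun s : R => f (s *: e)) t 1) /\
  {for (0 : R), continuous ('D_1 (fun s : R => f (s *: e)))}.
Proof.
move=> [df cf].
have c0 := @axis_continuous R V e 0.
split; last first.
  rewrite derive_axis.
  apply: (@continuous_comp _ _ _ (fun s : R => s *: e) ('D_e f)).
    exact: c0.
  by rewrite scale0r; exact: cf.
have := df; rewrite -(scale0r e) => /(near_continuous c0).
by apply: filterS => t dft; apply: derivable_axis; exact: diff_derivable.
Qed.

Lemma c1_coord (R : realType) n (i : 'I_n) (x : 'rV[R]_n) :
  c1_at (fun w : 'rV[R]_n => w 0 i) x.
Proof.
have dcoord y : differentiable (fun w : 'rV[R]_n => w 0 i) y.
  exact: differentiable_coord.
have Dcoord v y : is_derive y v (fun w : 'rV[R]_n => w 0 i) (v 0 i).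
  apply/is_derive_line.
  have -> : (fun h : R => (h *: v + y) 0 i) = (fun h => h * v 0 i + y 0 i).
    by apply/funext => h; rewrite !mxE.
  by apply: is_derive_eq; rewrite addr0 scaler0 add0r; exact: mulr1.
split; first by near=> y; exact: dcoord.
move=> v; have -> : 'D_v (fun w : 'rV[R]_n => w 0 i) = cst (v 0 i).
  by apply/funext => y; have [_ ->] := Dcoord v y.
exact: (@cst_continuous _ _ (v 0 i : R) x).
Unshelve. all: by end_near. Qed.

Lemma is_derive_coord (R : realType) (V : normedModType R) n
    (f : V -> 'rV[R]_n) x v i :
  differentiable f x ->
  is_derive x v (fun w => f w 0 i) ('D_v f x 0 i).
Proof.
move=> df; have dvf : derivable f x v by exact: diff_derivable df.
apply: DeriveDef; last by rewrite (derive_mx dvf) mxE.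
by move/derivable_mxP : dvf; exact.
Qed.

Lemma derive_comp (R : realType) (V W : normedModType R) n
    (f : V -> 'rV[R]_n) (g : 'rV[R]_n -> W) x v :
  differentiable f x -> differentiable g (f x) ->
  'D_v (g \o f) x = \sum_i ('D_v f x) 0 i *: 'D_(delta_mx 0 i) g (f x).
Proof.
move=> df dg; rewrite deriveE; last exact: differentiable_comp.
rewrite diff_comp // /= -(deriveE v df) {1}[_ x v]row_sum_delta.
rewrite linear_sum; apply: eq_bigr => i _.
by rewrite linearZ /= (deriveE _ dg).
Qed.

Lemma is_derive_comp_critical (R : realType) (V : normedModType R) n
    (f : V -> 'rV[R]_n) (g : 'rV[R]_n -> R) x v :
  differentiable f x -> differentiable g (f x) ->
  (forall i, 'D_(delta_mx 0 i) g (f x) = 0) ->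
  is_derive x v (g \o f) 0.
Proof.
move=> df dg g0; apply: DeriveDef.
  by apply: diff_derivable; exact: differentiable_comp.
by rewrite derive_comp // big1 // => i _; rewrite g0 scaler0.
Qed.

Lemma c1_at_comp (R : realType) (V W : normedModType R) n
    (f : V -> 'rV[R]_n) (g : 'rV[R]_n -> W) x :
  c1_at f x -> c1_at g (f x) -> c1_at (g \o f) x.
Proof.
move=> c1f c1g; have [df cf] := c1f; have [dg cg] := c1g.
have cfx := c1_continuous c1f.
have dgf : \forall y \near x, differentiable g (f y) by exact: (cfx _ dg).
split; first by near=> y; apply: differentiable_comp; near: y.
move=> v; rewrite /prop_for /continuous_at derive_comp; first last.
- exact: c1_differentiable.
- exact: c1_differentiable.
apply: (@cvg_trans _
  ((fun y => \sum_i ('D_v f y) 0 i *: 'D_(delta_mx 0 i) g (f y)) @ x)).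
  apply: near_eq_cvg; near=> y; rewrite derive_comp //; by near: y.
apply: cvg_big => [|i _]; first exact: add_continuous.
apply: cvgZ.
  apply: (@continuous_comp _ _ _ ('D_v f) (fun M : 'rV[R]_n => M 0 i)).
    exact: cf.
  exact: coord_continuous.
exact: (cvg_comp _ _ cfx (cg _)).
Unshelve. all: by end_near. Qed.

Lemma jacobian_comp (R : realType) m n p (f : 'rV[R]_m -> 'rV[R]_n)
    (g : 'rV[R]_n -> 'rV[R]_p) x :
  differentiable f x -> differentiable g (f x) ->
  jacobian (g \o f) x = jacobian f x *m jacobian g (f x).
Proof.
move=> df dg.
have dgf : differentiable (g \o f) x by exact: differentiable_comp.
apply/row_matrixP => i.
rewrite rowE -deriveEjacobian // deriveE // diff_comp //=.
by rewrite -!deriveE // !deriveEjacobian // rowE mulmxA.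
Qed.

Lemma jacobian_near_eq (R : realType) m n (f g : 'rV[R]_m -> 'rV[R]_n) x :
  differentiable f x -> differentiable g x ->
  (\forall y \near x, f y = g y) -> jacobian f x = jacobian g x.
Proof.
move=> df dg fg.
apply/row_matrixP => i.
rewrite [LHS]rowE [RHS]rowE.
rewrite -[LHS](deriveEjacobian _ df) -[RHS](deriveEjacobian _ dg).
exact: near_eq_derive.
Qed.

Lemma jacobian_id (R : realType) m (x : 'rV[R]_m) : jacobian id x = 1%:M.
Proof.
have idE : id = (fun y : 'rV[R]_m => y *m 1%:M + 0).
  by apply/funext => y; rewrite mulmx1 addr0.
by rewrite [X in jacobian X]idE jacobian_affine.
Qed.

Lemma det_jacobian2 (R : realType) (phi : 'rV[R]_2 -> 'rV[R]_2) x :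
  differentiable phi x -> 'D_(delta_mx 0 1) phi x 0 0 = 0 ->
  \det (jacobian phi x) =
  'D_(delta_mx 0 0) phi x 0 0 * 'D_(delta_mx 0 1) phi x 0 1.
Proof.
move=> dphi D10.
have JE i j : jacobian phi x i j = 'D_(delta_mx 0 i) phi x 0 j.
  by rewrite (deriveEjacobian _ dphi) -rowE [RHS]mxE.
rewrite -det_tr det_trig.
  rewrite !big_ord_recl big_ord0 mulr1 ![_^T _ _]mxE !JE.
  by have -> : lift ord0 ord0 = 1 :> 'I_2 by exact: val_inj.
apply/is_trig_mxP => i j ij; rewrite mxE JE -[RHS]D10.
have -> : i = 0.
  by apply: val_inj; case: i ij => -[|[]] // ? /leq_trans/(_ (ltn_ord j)).
by have -> : j = 1 by apply: val_inj; case: j ij => -[|[|]].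
Qed.

Lemma positive_diffeo_germ_c1 (R : realType) n (phi : 'rV[R]_n -> 'rV[R]_n) x :
  positive_diffeo_germ phi x -> c1_at phi x /\ 0 < \det (jacobian phi x).
Proof.
move=> [[A [B [psi [[[oA Ax] _] [sphi _] _ _]]]] /nbhs_singleton detphi].
by split; [exact: smooth_on_c1 sphi _ | exact: detphi].
Qed.

(** The Jacobians of phi and of its inverse multiply to the identity, so the
    inverse preserves orientation as well. *)
Lemma positive_diffeo_germ_inverse (R : realType) n
    (phi : 'rV[R]_n -> 'rV[R]_n) x :
  positive_diffeo_germ phi x ->
  exists psi : 'rV[R]_n -> 'rV[R]_n,
    [/\ c1_at psi (phi x), psi (phi x) = x,
        \forall z \near phi x, phi (psi z) = z &
        0 < \det (jacobian psi (phi x))].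
Proof.
move=> dphi; have [c1phi detphi] := positive_diffeo_germ_c1 dphi.
have [[A [B [psi [[[oA Ax] [oB Bx]] [_ spsi] AB BA]]]] _] := dphi.
have c1psi : c1_at psi (phi x) by exact: smooth_on_c1 spsi _.
have dphix := c1_differentiable c1phi; have dpsix := c1_differentiable c1psi.
exists psi; split; [exact: c1psi | by have [] := AB _ Ax | |].
  by apply: filterS (open_nbhs_nbhs (conj oB Bx)) => z /BA[].
have psiphi : \forall y \near x, (psi \o phi) y = id y.
  by apply: filterS (open_nbhs_nbhs (conj oA Ax)) => y /AB[].
have did : differentiable (@id 'rV[R]_n) x by apply: ex_diff.
have := jacobian_near_eq (differentiable_comp dphix dpsix) did psiphi.
rewrite jacobian_id (jacobian_comp dphix dpsix) => /(congr1 determinant).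
rewrite det_mulmx det1 => detM.
by rewrite -(pmulr_rgt0 _ detphi) detM ltr01.
Qed.

(** * The transition between two normal forms *)

Lemma bruce_west_map0 (R : realType) (a : 'rV[R]_2 -> R) (b : R -> R) :
  a 0 = 0 -> b 0 = 0 -> bruce_west_map a b 0 = 0.
Proof.
move=> a0 b0; rewrite /bruce_west_map /vec3 a0 !mxE b0 mulr0 addr0.
by apply/rowP => i; rewrite !mxE; case: i => [[|[|[|]]]].
Qed.

Lemma bruce_west_map_mul (R : realType) (a : 'rV[R]_2 -> R) (b : R -> R) w
    (Q : 'M[R]_3) j :
  (bruce_west_map a b w *m Q) 0 j =
  w 0 0 * Q 0 j + (w 0 0 * w 0 1 + b (w 0 1)) * Q 1 j + a w * Q ord_max j.
Proof.
rewrite mxE !big_ord_recl big_ord0 addr0 addrA !mxE /=.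
by congr (_ + _ + _); congr (_ * Q _ _); apply: val_inj.
Qed.

Lemma vec2_delta (R : realType) : vec2 1 0 = delta_mx 0 0 :> 'rV[R]_2 /\
  vec2 0 1 = delta_mx 0 1 :> 'rV[R]_2.
Proof. by split; apply/rowP => -[[|[|//]] ilt]; rewrite !mxE. Qed.

(** The analytic conditions on a pair of characteristic functions, reduced to
    two orders of differentiability and written with the canonical basis. *)
Definition bruce_west_conditions (R : realType) (a : 'rV[R]_2 -> R)
    (b : R -> R) : Prop :=
  let e2 : 'rV[R]_2 := delta_mx 0 1 in
  [/\ c1_at a 0, forall i, 'D_(delta_mx 0 i) a 0 = 0, c1_at ('D_e2 a) 0 &
      0 < 'D_e2 ('D_e2 a) 0] /\
  [/\ c1_at b 0, b 0 = 0, c1_at ('D_1 b) 0, 'D_1 b 0 = 0 &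
      'D_1 ('D_1 b) 0 = 0].

Lemma bruce_west_representation_conditions (R : realType)
    (f : 'rV[R]_2 -> 'rV[R]_3) (p : 'rV[R]_2) (a : 'rV[R]_2 -> R) (b : R -> R) :
  bruce_west_representation f p a b -> bruce_west_conditions a b.
Proof.
have [e1E e2E] := vec2_delta R.
move=> [[/smooth_at_c1[c1a c1Da] /smooth_at_c1[c1b c1Db]] [b0 Db0 DDb0]].
rewrite e1E e2E => -[a0 a1 a2 a22] _.
have DE : (b^`())%classic = 'D_1 b by apply/funext => x; exact: derive1E.
have a' i : 'D_(delta_mx 0 i) a 0 = 0.
  case: i => -[|[|i]] ilt; last discriminate ilt.
  - by rewrite -[RHS]a1; congr ('D_(delta_mx _ _) _ _); apply: val_inj.
  - by rewrite -[RHS]a2; congr ('D_(delta_mx _ _) _ _); apply: val_inj.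
have b' : 'D_1 b 0 = 0 := etrans (esym (derive1E b 0)) Db0.
have b'' : 'D_1 ('D_1 b) 0 = 0.
  apply: etrans (esym (derive1E _ 0)) _; rewrite -[RHS]DDb0.
  by congr (derive1 _ 0); apply/esym; exact: DE.
exact: (conj (And4 c1a a' (c1Da _) a22) (And5 c1b b0 (c1Db 1) b' b'')).
Qed.

(** Passing to the two charts, a positive congruence becomes a single relation
    between two normal forms, and since both normal forms send 0 to 0 the
    isometry that relates them is a rotation Q about the origin. *)
Lemma bruce_west_transition (R : realType) (f1 f2 : 'rV[R]_2 -> 'rV[R]_3)
    (p1 p2 : 'rV[R]_2) (a1 a2 : 'rV[R]_2 -> R) (b1 b2 : R -> R) :
  positively_congruent f2 p2 f1 p1 ->
  bruce_west_representation f1 p1 a1 b1 ->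
  bruce_west_representation f2 p2 a2 b2 ->
  exists (Q : 'M[R]_3) (phi : 'rV[R]_2 -> 'rV[R]_2),
    [/\ Q *m Q^T = 1%:M /\ 0 < \det Q, c1_at phi 0 /\ phi 0 = 0,
        0 < \det (jacobian phi 0) &
        \forall w \near (0 : 'rV[R]_2),
          bruce_west_map a1 b1 w = bruce_west_map a2 b2 (phi w) *m Q].
Proof.
move=> [T [theta [posT postheta theta1 f12]]].
move=> [_ [b10 _ _] [a10 _ _ _] [chart1 [S1 [chart1P chart10 posS1 S1f1]]]].
move=> [_ [b20 _ _] [a20 _ _ _] [chart2 [S2 [chart2P chart20 posS2 S2f2]]]].
have [A [AAT detA TA]] := positive_isometry_affine posT.
have [A1 [A1AT detA1 S1A]] := positive_isometry_affine posS1.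
have [A2 [A2AT detA2 S2A]] := positive_isometry_affine posS2.
have [psi [c1psi psi0 chart1psi detpsi]] :=
  positive_diffeo_germ_inverse chart1P.
rewrite chart10 in c1psi psi0 chart1psi detpsi.
have [c1theta dettheta] := positive_diffeo_germ_c1 postheta.
have [c1chart2 detchart2] := positive_diffeo_germ_c1 chart2P.
(* The isometry S1 o T o S2^-1, written for row vectors: x |-> x *m Q + c. *)
pose Q := A2^T *m A *m A1.
pose c := (- S2 0 *m A2^T *m A + T 0) *m A1 + S1 0.
pose phi := (chart2 \o theta) \o psi.
have c1chart2' : c1_at chart2 (theta p1) by rewrite theta1.
have c1ct : c1_at (chart2 \o theta) (psi 0).
  by rewrite psi0; exact: (c1_at_comp c1theta c1chart2').
have phi0 : phi 0 = 0 by rewrite /phi /= psi0 theta1 chart20.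
have cpsi := c1_continuous c1psi; have ctheta := c1_continuous c1theta.
rewrite /prop_for /continuous_at psi0 in cpsi.
rewrite /prop_for /continuous_at theta1 in ctheta.
have E : \forall w \near (0 : 'rV[R]_2),
    bruce_west_map a1 b1 w = bruce_west_map a2 b2 (phi w) *m Q + c.
  near=> w.
  have ew : chart1 (psi w) = w by near: w.
  have e1 : S1 (f1 (psi w)) = bruce_west_map a1 b1 (chart1 (psi w)).
    by near: w; exact: (cpsi _ S1f1).
  have e2 : S2 (f2 (theta (psi w))) = bruce_west_map a2 b2 (phi w).
    by near: w; exact: (cpsi _ (ctheta _ S2f2)).
  have e3 : f1 (psi w) = T (f2 (theta (psi w))) by near: w; exact: (cpsi _ f12).
  have A2Q : A2 *m Q = A *m A1 by rewrite /Q !mulmxA A2AT mul1mx.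
  rewrite ew in e1; rewrite -e1 -e2 S1A e3 TA S2A.
  rewrite [in RHS]mulmxDl -[_ *m A2 *m Q]mulmxA A2Q /c /Q.
  rewrite !mulmxDl !mulNmx !mulmxA.
  by rewrite -!addrA; congr (_ + _); rewrite addNKr.
have c0 : c = 0.
  by have := nbhs_singleton E; rewrite phi0 !bruce_west_map0 // mul0mx add0r.
exists Q, phi; split.
- rewrite /Q !trmx_mul trmxK; split.
    rewrite !mulmxA -[X in X *m A^T *m A2]mulmxA A1AT mulmx1.
    by rewrite -[X in X *m A2]mulmxA AAT mulmx1 (mulmx1C A2AT).
  by rewrite !det_mulmx det_tr; exact: (mulr_gt0 (mulr_gt0 detA2 detA) detA1).
- by split; [exact: (c1_at_comp c1psi c1ct) | exact: phi0].
- rewrite (jacobian_comp (c1_differentiable c1psi) (c1_differentiable c1ct)).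
  rewrite psi0.
  rewrite (jacobian_comp (c1_differentiable c1theta)
                         (c1_differentiable c1chart2')).
  rewrite theta1 !det_mulmx.
  exact: (mulr_gt0 detpsi (mulr_gt0 dettheta detchart2)).
- by near=> w; rewrite -[RHS]addr0 -c0; near: w; exact: E.
Unshelve. all: by end_near. Qed.

(** * First and second order of the transition at the cross cap *)

(** At the cross cap only the first coordinate of the normal form has a first
    order part. *)
Lemma is_derive_rotated_map (R : realType) (V : normedModType R)
    (phi : V -> 'rV[R]_2) (a : 'rV[R]_2 -> R) (b : R -> R) (Q : 'M[R]_3) x e j :
  differentiable phi x -> phi x = 0 ->
  differentiable a 0 -> (forall i, 'D_(delta_mx 0 i) a 0 = 0) ->
  is_derive (0 : R) 1 b 0 ->
  is_derive x e (fun w => (bruce_west_map a b (phi w) *m Q) 0 j)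
    ('D_e phi x 0 0 * Q 0 j).
Proof.
move=> dphi phi0 da a0 db.
have dU := is_derive_coord e 0 dphi; have dV := is_derive_coord e 1 dphi.
have dbV : is_derive x e (fun w => b (phi w 0 1)) 0.
  rewrite -(mul0r ('D_e phi x 0 1)).
  by apply: (@is_derive_comp1 _ _ b (fun w => phi w 0 1)); rewrite // phi0 mxE.
have daphi : is_derive x e (fun w => a (phi w)) 0.
  by apply: (is_derive_comp_critical (f := phi)); rewrite ?phi0.
have -> : (fun w => (bruce_west_map a b (phi w) *m Q) 0 j) =
    (fun w => phi w 0 0 * Q 0 j
       + (phi w 0 0 * phi w 0 1 + b (phi w 0 1)) * Q 1 j
       + a (phi w) * Q ord_max j).
  by apply/funext => w; rewrite bruce_west_map_mul.
apply: is_derive_eq; rewrite phi0 !mxE /GRing.scale /=; ring.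
Qed.

(** The differential of a normal form at 0 is that of (u, 0, 0): on the vector
    e the two sides are (e 0 0, 0, 0) and the first row of Q times the
    derivative of the first coordinate of phi. *)
Lemma transition_first_order (R : realType) (phi : 'rV[R]_2 -> 'rV[R]_2)
    (a1 a2 : 'rV[R]_2 -> R) (b1 b2 : R -> R) (Q : 'M[R]_3) :
  differentiable phi 0 -> phi 0 = 0 ->
  differentiable a1 0 -> (forall i, 'D_(delta_mx 0 i) a1 0 = 0) ->
  differentiable a2 0 -> (forall i, 'D_(delta_mx 0 i) a2 0 = 0) ->
  is_derive (0 : R) 1 b1 0 -> is_derive (0 : R) 1 b2 0 ->
  (\forall w \near (0 : 'rV[R]_2),
     bruce_west_map a1 b1 w = bruce_west_map a2 b2 (phi w) *m Q) ->
  forall e j, 'D_e phi 0 0 0 * Q 0 j = e 0 0 * (j == 0)%:R.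
Proof.
move=> dphi phi0 da1 a10 da2 a20 db1 db2 E e j.
have [_ <-] := is_derive_rotated_map Q e j dphi phi0 da2 a20 db2.
have did : differentiable (@id 'rV[R]_2) 0 by apply: ex_diff.
have [_] := is_derive_rotated_map 1%:M e j did erefl da1 a10 db1.
rewrite derive_id mxE eq_sym => <-; apply: near_eq_derive.
by apply: filterS E => w E; rewrite -E mulmx1.
Qed.

(** Along the v-axis the right-hand side runs through the normal form at the
    speed of a one-variable map g. At 0 its second derivative comes from a2
    alone, since b2 vanishes there with two derivatives, and is scaled by the
    square of that speed. *)
Lemma transition_second_order (R : realType) (phi : 'rV[R]_2 -> 'rV[R]_2)
    (a1 a2 : 'rV[R]_2 -> R) (b1 b2 : R -> R) (Q : 'M[R]_3) (eps : R) :
  let e2 : 'rV[R]_2 := delta_mx 0 1 in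
  c1_at phi 0 -> phi 0 = 0 ->
  (\forall w \near (0 : 'rV[R]_2), phi w 0 0 = w 0 0 * eps) ->
  c1_at a2 0 -> c1_at ('D_e2 a2) 0 -> 'D_e2 a2 0 = 0 ->
  c1_at b2 0 -> c1_at ('D_1 b2) 0 -> 'D_1 b2 0 = 0 -> 'D_1 ('D_1 b2) 0 = 0 ->
  (\forall w \near (0 : 'rV[R]_2),
     bruce_west_map a1 b1 w = bruce_west_map a2 b2 (phi w) *m Q) ->
  forall j, is_derive (0 : R) 1
    ('D_1 (fun v : R => bruce_west_map a1 b1 (v *: e2) 0 j))
    ('D_e2 ('D_e2 a2) 0 * Q ord_max j * ('D_e2 phi 0 0 1) ^+ 2).
Proof.
move=> e2 c1phi phi0 U c1a2 c1Da2 Da20 c1b2 c1Db2 Db20 DDb20 E j.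
(* On the axis u = 0 the first coordinates vanish on both sides, so phi moves
   that axis into itself by the one-variable map g. *)
pose g (v : R) : R := phi (v *: e2) 0 1.
pose f (v : R) : R := b2 v * Q 1 j + a2 (v *: e2) * Q ord_max j.
have c0 := @axis_continuous R 'rV[R]_2 e2 0.
have UE : \forall w \near 0 *: e2, phi w 0 0 = w 0 0 * eps /\
    bruce_west_map a1 b1 w = bruce_west_map a2 b2 (phi w) *m Q.
  by rewrite scale0r; exact: filterI U E.
have bwE : \forall v \near (0 : R),
    (f \o g) v = bruce_west_map a1 b1 (v *: e2) 0 j.
  have := near_continuous c0 UE; apply: filterS => v /= [Uv ->].
  rewrite bruce_west_map_mul.
  have -> : phi (v *: e2) = g v *: e2.
    apply/rowP => i; rewrite !mxE /=; case: i => -[|[|//]] ilt.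
    - rewrite mulr0; move: Uv; rewrite !mxE /= mulr0 mul0r => <-.
      by congr (phi _ _ _); apply: val_inj.
    - by rewrite mulr1 /g; congr (phi _ _ _); apply: val_inj.
  by rewrite !mxE /= mulr0 mul0r mul0r !add0r mulr1.
apply: (near_eq_is_derive (near_eq_derive_near _ bwE)).
have c1V : c1_at (fun w => phi w 0 1) 0.
  exact: (c1_at_comp c1phi (c1_coord _ _)).
have [dg cg'] := c1_axis e2 c1V.
have g0 : g 0 = 0 by rewrite /g scale0r phi0 mxE.
have dV := is_derive_coord e2 1 (c1_differentiable c1phi).
have [_ Dg0] : is_derive (0 : R) 1 g ('D_e2 phi 0 0 1) := is_derive_axis0 dV.
have db2 : \forall y \near (0 : R), derivable b2 y 1.
  by apply: filterS c1b2.1 => y ?; exact: diff_derivable.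
have [da2 _] := c1_axis e2 c1a2.
have DDb2 : is_derive (0 : R) 1 ('D_1 b2) 0.
  by apply: DeriveDef DDb20; exact: (diff_derivable (c1_differentiable c1Db2)).
have DDa2 : is_derive (0 : R) 1 ('D_1 (fun v : R => a2 (v *: e2)))
    ('D_e2 ('D_e2 a2) 0).
  rewrite derive_axis; apply: (is_derive_axis0 (f := 'D_e2 a2)).
  apply: derivableP.
  exact: (diff_derivable (c1_differentiable c1Da2)).
have [df Df0 DDf] :=
  second_order_combination (Q 1 j) (Q ord_max j) db2 da2 DDb2 DDa2.
have -> : 'D_e2 ('D_e2 a2) 0 * Q ord_max j =
    0 * Q 1 j + 'D_e2 ('D_e2 a2) 0 * Q ord_max j.
  by rewrite mul0r add0r.
have {}Df0 : 'D_1 f (g 0) = 0.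
  rewrite g0 [LHS]Df0 Db20 mul0r add0r.
  have [_ Da2] := is_derive_axis0
    (derivableP (diff_derivable (v := e2) (c1_differentiable c1a2))).
  by rewrite [X in X * _]Da2 Da20 mul0r.
have {}df : \forall y \near g 0, derivable f y 1 by rewrite g0; exact: df.
have {}DDf : is_derive (g 0) 1 ('D_1 f)
    (0 * Q 1 j + 'D_e2 ('D_e2 a2) 0 * Q ord_max j) by rewrite g0; exact: DDf.
exact: (derive2_comp_critical df Df0 DDf dg Dg0 cg').
Qed.

(** * Rigidity of the parameter on the surface *)

(** The derivative along e of the identity u v + b1 v = u V + k b2 V, which
    says that v and V are two Bruce-West parameters for the same second
    coordinate, up to a factor k. *)
Lemma graph_identity_derive (R : realType) (V : 'rV[R]_2 -> R)
    (b1 b2 : R -> R) (k : R) :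
  c1_at V 0 -> V 0 = 0 -> c1_at b1 0 -> c1_at b2 0 ->
  (\forall w \near (0 : 'rV[R]_2),
     (w : 'rV[R]_2) 0 0 * w 0 1 + b1 (w 0 1) = w 0 0 * V w + k * b2 (V w)) ->
  forall e : 'rV[R]_2, \forall w \near (0 : 'rV[R]_2),
    e 0 0 * (w : 'rV[R]_2) 0 1 + (w 0 0 + 'D_1 b1 (w 0 1)) * e 0 1 =
    e 0 0 * V w + (w 0 0 + k * 'D_1 b2 (V w)) * 'D_e V w.
Proof.
move=> c1V V0 [db1 _] [db2 _] E e.
have cy : {for (0 : 'rV[R]_2), continuous (fun w : 'rV[R]_2 => w 0 1)}.
  exact: c1_continuous (c1_coord _ _).
have cV := c1_continuous c1V.
have nb1 : \forall w \near (0 : 'rV[R]_2),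
    differentiable b1 ((w : 'rV[R]_2) 0 1).
  have db1' : \forall y \near (0 : 'rV[R]_2) 0 1, differentiable b1 y.
    by rewrite mxE.
  exact: near_continuous cy db1'.
have nb2 : \forall w \near (0 : 'rV[R]_2), differentiable b2 (V w).
  have db2' : \forall y \near V 0, differentiable b2 y by rewrite V0.
  exact: near_continuous cV db2'.
have nE := near_eq_derive_near e E.
have [nV _] := c1V.
near=> w.
have dV : is_derive w e V ('D_e V w).
  by apply/derivableP/diff_derivable; near: w; exact: nV.
have Db1 : is_derive (w 0 1) 1 b1 ('D_1 b1 (w 0 1)).
  by apply/derivableP/diff_derivable; near: w; exact: nb1.
have Db2 : is_derive (V w) 1 b2 ('D_1 b2 (V w)).
  by apply/derivableP/diff_derivable; near: w; exact: nb2.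
have did : differentiable (@id 'rV[R]_2) w by apply: ex_diff.
have dx := is_derive_coord e 0 did; have dy := is_derive_coord e 1 did.
rewrite derive_id in dx dy.
have Db1y : is_derive w e (fun w => b1 (w 0 1)) ('D_1 b1 (w 0 1) * e 0 1).
  exact: (is_derive_comp1 (g := fun w : 'rV[R]_2 => w 0 1)).
have Db2V : is_derive w e (fun w => b2 (V w)) ('D_1 b2 (V w) * 'D_e V w).
  exact: (is_derive_comp1 (g := V)).
have L : is_derive w e (fun w => w 0 0 * w 0 1 + b1 (w 0 1))
    (e 0 0 * w 0 1 + (w 0 0 + 'D_1 b1 (w 0 1)) * e 0 1).
  apply: is_derive_eq; rewrite /GRing.scale /=; ring.
have Rt : is_derive w e (fun w => w 0 0 * V w + k * b2 (V w))
    (e 0 0 * V w + (w 0 0 + k * 'D_1 b2 (V w)) * 'D_e V w).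
  apply: is_derive_eq; rewrite /GRing.scale /=; ring.
have [_ <-] := L; have [_ <-] := Rt; near: w; exact: nE.
Unshelve. all: by end_near. Qed.

(** The coefficient of u v is 1 in both normal forms and b2 has no term of
    order two, so V has unit speed at the cross cap whatever the factor k. *)
Lemma graph_fibre_speed (R : realType) (V : 'rV[R]_2 -> R)
    (b1 b2 : R -> R) (k : R) :
  c1_at V 0 -> V 0 = 0 -> c1_at b1 0 -> c1_at b2 0 ->
  is_derive (0 : R) 1 ('D_1 b2) 0 -> 'D_1 b2 0 = 0 ->
  (\forall w \near (0 : 'rV[R]_2),
     (w : 'rV[R]_2) 0 0 * w 0 1 + b1 (w 0 1) = w 0 0 * V w + k * b2 (V w)) ->
  'D_(delta_mx 0 1) V 0 = 1.
Proof.
move=> c1V V0 c1b1 c1b2 DDb2 Db20 E.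
pose e2 : 'rV[R]_2 := delta_mx 0 1; pose e1 : 'rV[R]_2 := delta_mx 0 0.
have H1 := graph_identity_derive c1V V0 c1b1 c1b2 E e1.
pose g (v : R) : R := V (v *: e2).
have c0 := @axis_continuous R 'rV[R]_2 e2 0.
have dg : is_derive (0 : R) 1 g ('D_e2 V 0).
  apply: is_derive_axis0; apply: derivableP.
  exact: (diff_derivable (c1_differentiable c1V)).
have g0 : g 0 = 0 by rewrite /g scale0r.
(* On the axis u = 0 the derivative of the graph identity along u reads
   v - g v = k * b2' (g v) * V_u, where b2' (g v) vanishes to second order:
   differentiating at v = 0 gives 1 - g'(0) = 0. *)
pose h (v : R) := k * 'D_1 b2 (g v).
pose m (v : R) := 'D_e1 V (v *: e2).
have dDb2g : is_derive (0 : R) 1 ('D_1 b2 \o g) 0.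
  rewrite -[X in is_derive _ _ _ X](mul0r ('D_e2 V 0)).
  by apply: is_derive_comp1; rewrite // g0.
have dh : is_derive (0 : R) 1 h 0.
  have := @is_deriveZ _ _ _ _ k _ _ _ dDb2g; rewrite scaler0; exact.
have h0 : h 0 = 0 by rewrite /h g0 Db20 mulr0.
have cm : {for (0 : R), continuous m}.
  apply: (@continuous_comp _ _ _ (fun s : R => s *: e2) ('D_e1 V)).
    exact: c0.
  by rewrite scale0r; exact: c1V.2.
have dhm := is_derive_mul_vanishing dh h0 cm.
have dd : is_derive (0 : R) 1 (fun v => v - g v) (1 - 'D_e2 V 0).
  exact: (@is_deriveB _ _ _ id g _ _ _ _ (is_derive_id _ _) dg).
have nE : \forall v \near (0 : R), h v * m v = v - g v.
  have Hu : \forall w \near 0 *: e2,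
      (w : 'rV[R]_2) 0 1 = V w + (w 0 0 + k * 'D_1 b2 (V w)) * 'D_e1 V w.
    rewrite scale0r; apply: filterS H1 => w.
    by rewrite !mxE /= !mul1r mulr0 addr0.
  apply: filterS (near_continuous c0 Hu) => v.
  rewrite !mxE /= mulr1 mulr0 add0r => Hv.
  by rewrite [X in X - _]Hv addrAC subrr add0r.
have [_] := near_eq_is_derive nE dhm.
have [_ ->] := dd.
by rewrite mul0r => /eqP; rewrite subr_eq0 => /eqP.
Qed.

(** The parameter v in y = u v + b v is determined by the map
    (u, v) |-> (u, y).

    Differentiating u v + b1 v = u V + b2 V along u and v gives
      v - V = (u + b2' V) V_u   and   u + b1' v = (u + b2' V) V_v.
    On the singular curve u = - b1' v the second equation yields
    u + b2' V = 0, because V_v is not 0, and then the first one yields V = v;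
    geometrically, v is the slope of the apparent contour, which does not
    depend on the parameter. Hence b1' = b2', and b1 = b2. Elsewhere put
    h = V - v. If h is not 0 then u h + b2 V - b2 v = 0 and the mean value
    theorem give u = - b2' z with z between v and V, so
      h = - (b2' V - b2' z) V_u,
    which is at most |h| / 2 in absolute value as b2'' is small near 0: a
    contradiction. *)
Lemma graph_rigidity (R : realType) (V : 'rV[R]_2 -> R) (b1 b2 : R -> R) :
  c1_at V 0 -> V 0 = 0 -> 'D_(delta_mx 0 1) V 0 != 0 ->
  c1_at b1 0 -> b1 0 = 0 -> c1_at ('D_1 b1) 0 -> 'D_1 b1 0 = 0 ->
  c1_at b2 0 -> b2 0 = 0 -> c1_at ('D_1 b2) 0 -> 'D_1 ('D_1 b2) 0 = 0 ->
  (\forall w \near (0 : 'rV[R]_2),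
     (w : 'rV[R]_2) 0 0 * w 0 1 + b1 (w 0 1) = w 0 0 * V w + b2 (V w)) ->
  (\forall w \near (0 : 'rV[R]_2), V w = w 0 1) /\
  (\forall v \near (0 : R), b1 v = b2 v).
Proof.
move=> c1V V0 Vv0 c1b1 b10 c1Db1 Db10 c1b2 b20 c1Db2 DDb20 E.
pose e2 : 'rV[R]_2 := delta_mx 0 1; pose e1 : 'rV[R]_2 := delta_mx 0 0.
have E1 : \forall w \near (0 : 'rV[R]_2),
    (w : 'rV[R]_2) 0 0 * w 0 1 + b1 (w 0 1) = w 0 0 * V w + 1 * b2 (V w).
  by apply: filterS E => w ->; rewrite mul1r.
have Hu : \forall w \near (0 : 'rV[R]_2),
    (w : 'rV[R]_2) 0 1 = V w + (w 0 0 + 'D_1 b2 (V w)) * 'D_e1 V w.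
  apply: filterS (graph_identity_derive c1V V0 c1b1 c1b2 E1 e1) => w.
  by rewrite !mxE /= !mul1r mulr0 addr0.
have Hv : \forall w \near (0 : 'rV[R]_2),
    (w : 'rV[R]_2) 0 0 + 'D_1 b1 (w 0 1) = (w 0 0 + 'D_1 b2 (V w)) * 'D_e2 V w.
  apply: filterS (graph_identity_derive c1V V0 c1b1 c1b2 E1 e2) => w.
  by rewrite !mxE /= !mul0r mulr1 !add0r mul1r.
have cV := c1_continuous c1V.
have cx : {for (0 : 'rV[R]_2), continuous (fun w : 'rV[R]_2 => w 0 1)}.
  exact: c1_continuous (c1_coord _ _).
have b12 : \forall v \near (0 : R), b1 v = b2 v.
  (* The curve u + b1' v = 0 consists of the points where (u, v) |->
     (u, u v + b1 v) is singular. *)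
  pose sing (v : R) : 'rV[R]_2 := (- 'D_1 b1 v) *: e1 + v *: e2.
  have csing : {for (0 : R), continuous sing}.
    apply: (@continuousD _ _ _ (fun v : R => (- 'D_1 b1 v) *: e1)
                               (fun v : R => v *: e2)).
      apply: (@continuous_comp _ _ _ (fun v : R => - 'D_1 b1 v)
                                     (fun s : R => s *: e1)).
        by apply: (@continuousN _ _ _ ('D_1 b1)); exact: c1_continuous c1Db1.
      exact: axis_continuous.
    exact: axis_continuous.
  have sing0 : sing 0 = 0 by rewrite /sing Db10 oppr0 !scale0r addr0.
  have nVv : \forall w \near (0 : 'rV[R]_2), 'D_e2 V w != 0.
    exact: (cvgr_neq0 _ (c1V.2 e2) Vv0).
  have Hall : \forall w \near sing 0,
     [/\ (w : 'rV[R]_2) 0 1 = V w + (w 0 0 + 'D_1 b2 (V w)) * 'D_e1 V w,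
        w 0 0 + 'D_1 b1 (w 0 1) = (w 0 0 + 'D_1 b2 (V w)) * 'D_e2 V w &
        'D_e2 V w != 0].
    rewrite sing0; near=> w; split; near: w; [exact: Hu|exact: Hv|exact: nVv].
  have Db12 : \forall v \near (0 : R), 'D_1 b1 v = 'D_1 b2 v.
    apply: filterS (near_continuous csing Hall) => v [].
    rewrite !mxE /= !mulr1 !mulr0 addr0 add0r addNr => Hu1 /esym/eqP Hv1 nz.
    move: Hv1; rewrite mulf_eq0 (negbTE nz) orbF => /eqP Hv1.
    rewrite Hv1 mul0r addr0 in Hu1; rewrite -Hu1 addrC in Hv1.
    by apply/esym/eqP; rewrite -subr_eq0 Hv1.
  have [r r0 rP] : exists2 r : R, 0 < r & forall v, `|v| < r ->
      [/\ derivable b1 v 1, derivable b2 v 1 & 'D_1 b1 v = 'D_1 b2 v].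
    apply: near0_ball; near=> v; split; last by near: v; exact: Db12.
      by apply: diff_derivable; near: v; exact: c1b1.1.
    by apply: diff_derivable; near: v; exact: c1b2.1.
  apply: (near_ball0 r0) => v vr.
  have db z : `|z| < r -> derivable (b1 - b2) z 1.
    by move=> /rP[d1 d2 _]; exact: derivableB.
  have [||z [/rP[d1 d2 d12] _]] := mvt_ball db (x := 0) (y := v);
    rewrite ?normr0 //.
  rewrite deriveB // d12 subrr mul0r !fctE b10 b20 subrr subr0 => /eqP.
  by rewrite subr_eq0 => /eqP.
split; last exact: b12.
(* K bounds V_u near 0, and b2'' is below 1 / (2 K) near
   0, which makes |h| at most |h| / 2. *)
pose K := `|'D_e1 V 0| + 1.
have K0 : 0 < K by rewrite ltr_wpDl.
have nK : \forall w \near (0 : 'rV[R]_2), `|'D_e1 V w| < K.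
  by apply: (cvgr_norm_lt _ (c1V.2 e1)); rewrite ltrDl.
have [r r0 rP] : exists2 r : R, 0 < r & forall v, `|v| < r ->
    [/\ derivable b2 v 1, derivable ('D_1 b2) v 1,
        `|'D_1 ('D_1 b2) v| < (2 * K)^-1 & b1 v = b2 v].
  apply: near0_ball; near=> v; split.
  - by apply: diff_derivable; near: v; exact: c1b2.1.
  - by apply: diff_derivable; near: v; exact: c1Db2.1.
  - near: v.
    apply: (cvgr_norm_lt _ (c1Db2.2 1)).
    by rewrite DDb20 normr0 invr_gt0 mulr_gt0.
  - by near: v; exact: b12.
have ball0 (y : R) : y = 0 -> \forall z \near y, `|z| < r.
  move=> ->; exact: (near_ball0 r0).
have nV : \forall w \near (0 : 'rV[R]_2), `|V w| < r.
  exact: (near_continuous cV (ball0 _ V0)).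
have ny : \forall w \near (0 : 'rV[R]_2), `|(w : 'rV[R]_2) 0 1| < r.
  by apply: (near_continuous cx (ball0 _ _)); rewrite mxE.
near=> w.
have Ew : w 0 0 * w 0 1 + b1 (w 0 1) = w 0 0 * V w + b2 (V w).
  by near: w; exact: E.
have Huw : w 0 1 = V w + (w 0 0 + 'D_1 b2 (V w)) * 'D_e1 V w.
  by near: w; exact: Hu.
have Kw : `|'D_e1 V w| < K by near: w; exact: nK.
have Vr : `|V w| < r by near: w; exact: nV.
have yr : `|w 0 1| < r by near: w; exact: ny.
apply/eqP; apply: contraT => Vny.
have hn0 : V w - w 0 1 != 0 by rewrite subr_eq0.
have [_ _ _ b12w] := rP _ yr; rewrite b12w in Ew.
have d1 z : `|z| < r -> derivable b2 z 1 by case/rP.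
have d2 z : `|z| < r -> derivable ('D_1 b2) z 1 by case/rP.
have [z [zr zV bE]] := mvt_ball d1 yr Vr.
have wE : w 0 0 = - 'D_1 b2 z.
  apply/eqP; rewrite -addr_eq0 -(mulIr_eq0 _ (mulIf hn0)) mulrDl -bE mulrBr.
  by apply/eqP; rewrite addrACA -Ew [in X in _ + X]addrC; ring.
have [z' [z'r _ DbE]] := mvt_ball d2 zr Vr.
have [_ _ z'K _] := rP _ z'r.
have hE : w 0 1 - V w = 'D_1 ('D_1 b2) z' * (V w - z) * 'D_e1 V w.
  by rewrite -DbE {1}Huw wE addrAC subrr add0r [- _ + _]addrC.
have : `|V w - w 0 1| <= (2 * K)^-1 * `|V w - w 0 1| * K.
  rewrite -{1}distrC hE !normrM; apply: ler_pM => //; last exact: ltW.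
    by rewrite mulr_ge0.
  by apply: ler_pM => //; [exact: ltW | rewrite distrC].
have hpos : 0 < `|V w - w 0 1| by rewrite normr_gt0.
have -> : (2 * K)^-1 * `|V w - w 0 1| * K = `|V w - w 0 1| / 2.
  by rewrite mulrAC invfM (mulfVK (lt0r_neq0 K0)) mulrC.
by rewrite leNgt ltr_pdivrMr // mulr_natr mulr2n ltrDl hpos.
Unshelve. all: by end_near. Qed.

(** * Invariance of the characteristic functions *)

Lemma characteristic_functions_invariant (R : realType)
    (f1 f2 : 'rV[R]_2 -> 'rV[R]_3) (p1 p2 : 'rV[R]_2)
    (a1 a2 : 'rV[R]_2 -> R) (b1 b2 : R -> R) :
  positively_congruent f2 p2 f1 p1 ->
  bruce_west_representation f1 p1 a1 b1 ->
  bruce_west_representation f2 p2 a2 b2 ->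
  (\forall w \near (0 : 'rV[R]_2), a1 w = a2 w) /\
  (\forall v \near (0 : R), b1 v = b2 v).
Proof.
move=> congr12 rep1 rep2.
have [Q [phi [[QQT detQ] [c1phi phi0] detphi E]]] :=
  bruce_west_transition congr12 rep1 rep2.
have [[c1a1 a1' c1Da1 a1'']] := bruce_west_representation_conditions rep1.
move=> [c1b1 b10 c1Db1 b1' b1''].
have [[c1a2 a2' c1Da2 a2'']] := bruce_west_representation_conditions rep2.
move=> [c1b2 b20 c1Db2 b2' b2''].
pose e1 : 'rV[R]_2 := delta_mx 0 0; pose e2 : 'rV[R]_2 := delta_mx 0 1.
have dphi := c1_differentiable c1phi.
have isb1 : is_derive (0 : R) 1 b1 0.
  by apply: DeriveDef b1'; exact: (diff_derivable (c1_differentiable c1b1)).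
have isb2 : is_derive (0 : R) 1 b2 0.
  by apply: DeriveDef b2'; exact: (diff_derivable (c1_differentiable c1b2)).
have DDb2 : is_derive (0 : R) 1 ('D_1 b2) 0.
  by apply: DeriveDef b2''; exact: (diff_derivable (c1_differentiable c1Db2)).
have first := transition_first_order dphi phi0 (c1_differentiable c1a1) a1'
  (c1_differentiable c1a2) a2' isb1 isb2 E.
have UQ := first e1 0; rewrite !mxE eqxx /= mulr1 in UQ.
have U0 : 'D_e1 phi 0 0 0 != 0.
  by apply: contra_eq_neq UQ => ->; rewrite mul0r eq_sym oner_eq0.
have Q01 : Q 0 1 = 0.
  by apply: (mulfI U0); rewrite (first e1) /= !mulr0.
have Q02 : Q 0 ord_max = 0.
  by apply: (mulfI U0); rewrite (first e1) /= !mulr0.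
have [Q00 Q10 Q20] := orthogonal3_first_row QQT Q01 Q02.
have Q00n0 : Q 0 0 != 0 by rewrite -sqrf_eq0 Q00 oner_eq0.
have Uv0 : 'D_e2 phi 0 0 0 = 0.
  by apply: (mulIf Q00n0); rewrite (first e2) !mxE /= !mul0r.
rewrite (det_jacobian2 dphi Uv0) in detphi.
have Vv0 : 'D_e2 phi 0 0 1 != 0.
  by apply/eqP => Vv; move: detphi; rewrite [X in _ * X]Vv mulr0 ltxx.
have UE : \forall w \near (0 : 'rV[R]_2), phi w 0 0 = w 0 0 * Q 0 0.
  apply: filterS E => w /(congr1 (fun M : 'rV[R]_3 => M 0 0)).
  rewrite bruce_west_map_mul Q10 Q20 !mulr0 !addr0 !mxE /= => ->.
  by rewrite -mulrA -expr2 Q00 mulr1.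
(* The second derivatives at 0 along the v-axis determine the last row of Q. *)
have second := transition_second_order c1phi phi0 UE c1a2 c1Da2 (a2' 1)
  c1b2 c1Db2 b2' b2'' E.
have b1E : (fun v : R => bruce_west_map a1 b1 (v *: e2) 0 1) = b1.
  by apply/funext => v; rewrite !mxE /= mulr0 mul0r add0r mulr1.
have a1E : (fun v : R => bruce_west_map a1 b1 (v *: e2) 0 ord_max) =
    (fun v : R => a1 (v *: e2)).
  by apply/funext => v; rewrite !mxE.
have c2 : 0 < 'D_e2 phi 0 0 1 ^+ 2 by rewrite exprn_even_gt0.
have Q21 : Q ord_max 1 = 0.
  have := second 1; rewrite b1E => -[_]; rewrite b1'' => /esym/eqP.
  by rewrite mulf_eq0 (gt_eqF c2) orbF mulf_eq0 (gt_eqF a2'') => /eqP.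
have Q22 : 0 < Q ord_max ord_max.
  have := second ord_max; rewrite a1E derive_axis.
  have [_ D2] := is_derive_axis0 (f := 'D_e2 a1)
    (derivableP (diff_derivable (v := e2) (c1_differentiable c1Da1))).
  rewrite -/e2 => -[_]; rewrite [LHS]D2 => a1E'.
  have := a1''; rewrite [X in 0 < X]a1E'.
  by rewrite (pmulr_lgt0 _ c2) (pmulr_rgt0 _ a2''); exact.
(* Q = diag (eps, eps, 1) with eps = Q 0 0 = 1 or -1. *)
have [Q11 Q12 Q22E] := rotation3_diag QQT detQ Q01 Q02 Q21 Q22.
pose V (w : 'rV[R]_2) := phi w 0 1.
have c1V : c1_at V 0 by exact: (c1_at_comp c1phi (c1_coord _ _)).
have V0 : V 0 = 0 by rewrite /V phi0 mxE.
have DV : 'D_e2 V 0 = 'D_e2 phi 0 0 1.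
  by have [_ ->] := is_derive_coord e2 1 dphi.
have graph : \forall w \near (0 : 'rV[R]_2),
    (w : 'rV[R]_2) 0 0 * w 0 1 + b1 (w 0 1) = w 0 0 * V w + Q 0 0 * b2 (V w).
  apply: filterS (filterI E UE) => w [] /(congr1 (fun M : 'rV[R]_3 => M 0 1)).
  rewrite bruce_west_map_mul Q01 Q21 Q11 !mulr0 addr0 add0r !mxE /= => -> ->.
  rewrite mulrDl [_ * Q 0 0]mulrAC -[_ * Q 0 0 * Q 0 0]mulrA -expr2 Q00 mulr1.
  by rewrite [Q 0 0 * _]mulrC.
have Vv1 := graph_fibre_speed c1V V0 c1b1 c1b2 DDb2 b2' graph.
(* The Jacobian of phi at 0 is triangular with diagonal (eps, 1), so its
   positive determinant forces eps = 1. *)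
have Vphi1 : 'D_e2 phi 0 0 1 = 1 := etrans (esym DV) Vv1.
have Q00E : Q 0 0 = 1.
  have Qpos : 0 < Q 0 0.
    rewrite [X in _ * X]Vphi1 mulr1 in detphi.
    by rewrite -(pmulr_rgt0 _ detphi) UQ.
  by apply/eqP; rewrite -(@eqrXn2 _ 2) ?ltW // expr1n Q00.
have graph1 : \forall w \near (0 : 'rV[R]_2),
    (w : 'rV[R]_2) 0 0 * w 0 1 + b1 (w 0 1) = w 0 0 * V w + b2 (V w).
  by apply: filterS graph => w ->; rewrite Q00E mul1r.
have Vn0 : 'D_e2 V 0 != 0 by rewrite DV.
have [VE b12] := graph_rigidity c1V V0 Vn0 c1b1 b10 c1Db1 b1'
  c1b2 b20 c1Db2 b2'' graph1.
split; last exact: b12.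
apply: filterS (filterI E (filterI UE VE)) => w [Ew [Uw Vw]].
have phiw : phi w = w.
  apply/rowP => -[[|[|//]] ilt].
  - have -> : Ordinal ilt = 0 by exact: val_inj.
    by rewrite Uw Q00E mulr1.
  - have -> : Ordinal ilt = 1 by exact: val_inj.
    exact: Vw.
have := congr1 (fun M : 'rV[R]_3 => M 0 ord_max) Ew.
by rewrite phiw bruce_west_map_mul Q02 Q12 Q22E !mulr0 !add0r mulr1 mxE.
Qed.

Lemma norm_vec2_lt (R : realType) (u v r : R) :
  0 < r -> `|u| < r -> `|v| < r -> `|vec2 u v| < r.
Proof.
move=> r0 ur vr; rewrite [ltLHS]/Num.Def.normr /= mx_normrE.
apply/bigmax_ltP; split=> // -[i [[|[|//]] jlt]] _; by rewrite mxE.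
Qed.

Theorem theoremB (R : realType)
    (U1 U2 : set 'rV[R]_2) (p1 p2 : 'rV[R]_2)
    (f1 f2 : 'rV[R]_2 -> 'rV[R]_3)
    (a1 a2 : 'rV[R]_2 -> R) (b1 b2 : R -> R)
    (U1_nbhs : open_nbhs p1 U1) (U2_nbhs : open_nbhs p2 U2)
    (f1_smooth : smooth_on U1 f1) (f2_smooth : smooth_on U2 f2)
    (f1_cross_cap : cross_cap_at f1 p1) (f2_cross_cap : cross_cap_at f2 p2)
    (a1_first : first_characteristic_function f1 p1 a1)
    (b1_second : second_characteristic_function f1 p1 b1)
    (a2_first : first_characteristic_function f2 p2 a2)
    (b2_second : second_characteristic_function f2 p2 b2)
    (f2_congr_f1 : positively_congruent f2 p2 f1 p1) :
  exists2 eps : R, 0 < eps &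
    forall u v : R, `|u| < eps -> `|v| < eps ->
      a1 (vec2 u v) = a2 (vec2 u v) /\ b1 v = b2 v.
Proof.
(* A first characteristic function comes with a companion b, a second one with
   a companion a, and the companions may belong to different representations:
   the invariance is applied once for the a's and once for the b's. *)
have [b1' rep_a1] := a1_first; have [b2' rep_a2] := a2_first.
have [a1' rep_b1] := b1_second; have [a2' rep_b2] := b2_second.
have [/near0_ball[r r0 ra] _] :=
  characteristic_functions_invariant f2_congr_f1 rep_a1 rep_a2.
have [_ /near0_ball[s s0 sb]] :=
  characteristic_functions_invariant f2_congr_f1 rep_b1 rep_b2.
exists (Num.min r s); first by rewrite lt_min r0.
move=> u v; rewrite !lt_min => /andP[ur _] /andP[vr vs].
by split; [apply: ra; exact: norm_vec2_lt | exact: sb].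
Qed.
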